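(* Let $k$ be a field and $A=k[x_1,\ldots,x_d]$ the polynomial Hopf algebra. A linear map $q:A\to A\otimes A$ gives a co-Poisson Hopf algebra structure on $A$ if and only if there is a linear map $I:A\to A\otimes A$ such that: (1) $q(a)=\sum I(a_1)\Delta(a_2)$ for all monic monomials $a\in A$; (2) $I(a)=0$ for every monic monomial $a\notin\{x_1,\ldots,x_d\}$, and for all $1\le s\le d$, $I(x_s)=\sum_{1\le i,j\le d}\lambda_s^{ij}\,x_i\otimes x_j\in\mathcal{I}$ with $(\lambda_s^{ij})_{d\times d}\in M_d(k)$ skew-symmetric; (3) for all $1\le i<j<m\le d$ and $1\le s\le d$, $$\sum_{l=1}^d\left(\lambda_s^{lm}\lambda_l^{ij}+\lambda_s^{li}\lambda_l^{jm}+\lambda_s^{lj}\lambda_l^{mi}\right)=0.$$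
   Context: $A=k[x_1,\ldots,x_d]$ is the Hopf algebra (universal enveloping algebra of the $d$-dimensional abelian Lie algebra) whose comultiplication $\Delta$ is the algebra map with $\Delta(x_i)=x_i\otimes1+1\otimes x_i$. Sweedler notation: $\Delta(a)=\sum a_1\otimes a_2$; products are taken in $A\otimes A$. $\mathcal{I}=\bigoplus_{i<j}k(x_i\otimes x_j-x_j\otimes x_i)\subseteq A\otimes A$. $t_n:V^{\otimes n}\to V^{\otimes n}$ is $v_1\otimes\cdots\otimes v_n\mapsto v_n\otimes v_1\otimes\cdots\otimes v_{n-1}$. A linear map $q:A\to A\otimes A$ gives a co-Poisson Hopf algebra structure on $A$ if $(1+t_2)q=0$, $(1+t_3+t_3^2)(q\otimes1)q=0$, $(\Delta\otimes1)q=(1\otimes q)\Delta-t_3^2(q\otimes1)\Delta$, and $q(ab)=q(a)\Delta(b)+\Delta(a)q(b)$ for all $a,b\in A$.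
   Formalization: The ''only if'' direction is stated only for k of characteristic 0, since it fails in characteristic p>0 for d≥1 (e.g. q(x_1)=x_1⊗x_1^p−x_1^p⊗x_1, q(x_s)=0 otherwise); the ''if'' direction is stated for every field k. *)

(* Defs.v *)
From HB Require Import structures.
From mathcomp Require Import all_boot all_algebra.
From mathcomp.multinomials Require Export mpoly.

Set Implicit Arguments.
Unset Strict Implicit.
Unset Printing Implicit Defensive.

Import GRing.Theory.
Local Open Scope ring_scope.

Reserved Notation "a \ox b" (at level 40, left associativity).

(** ** Tensor products of polynomial algebras

   k[x_1..x_m] (x) k[y_1..y_n] is realised as k[x_1..x_m, y_1..y_n], that is
   {mpoly k[m + n]}: [tens a b] is the pure tensor a (x) b, and [tlift f] is
   the linear map induced by a bilinear f.  [tlift_linear], [tlift_tens] and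
   [tens_ext] are the universal property; [tensM] and [tens11] say that the
   ring structure of {mpoly k[m + n]} is that of the tensor product algebra. *)

Section Tensor.
Variable k : fieldType.

Definition tens (m n : nat) (a : {mpoly k[m]}) (b : {mpoly k[n]}) :
    {mpoly k[m + n]} :=
  (a \mPo [tuple 'X_(lshift n i) | i < m])
  * (b \mPo [tuple 'X_(rshift m j) | j < n]).

Definition lmon (m n : nat) (mu : 'X_{1..(m + n)}) : 'X_{1..m} :=
  [multinom mu (lshift n i) | i < m].
Definition rmon (m n : nat) (mu : 'X_{1..(m + n)}) : 'X_{1..n} :=
  [multinom mu (rshift m j) | j < n].

Definition tlift (m n : nat) (W : lmodType k)
    (f : {mpoly k[m]} -> {mpoly k[n]} -> W) (u : {mpoly k[m + n]}) : W :=
  \sum_(mu <- msupp u) u@_mu *: f 'X_[lmon mu] 'X_[rmon mu].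

Local Notation "a \ox b" := (tens a b).

(* f (x) g *)
Definition tmap (m n m' n' : nat)
    (f : {mpoly k[m]} -> {mpoly k[m']}) (g : {mpoly k[n]} -> {mpoly k[n']}) :
    {mpoly k[m + n]} -> {mpoly k[m' + n']} :=
  tlift (fun a b => f a \ox g b).

(* a (x) b |-> b (x) a *)
Definition tswap (m n : nat) : {mpoly k[m + n]} -> {mpoly k[n + m]} :=
  tlift (fun a b => b \ox a).

(* a (x) (b (x) c) |-> (a (x) b) (x) c *)
Definition tassoc (m n p : nat) :
    {mpoly k[m + (n + p)]} -> {mpoly k[m + n + p]} :=
  tlift (fun a => tlift (fun b c => a \ox b \ox c)).

Lemma tensM m n (a a' : {mpoly k[m]}) (b b' : {mpoly k[n]}) :
  (a \ox b) * (a' \ox b') = (a * a') \ox (b * b').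
Proof. by rewrite /tens !rmorphM /= mulrACA. Qed.

Lemma tens11 m n : (1 : {mpoly k[m]}) \ox (1 : {mpoly k[n]}) = 1.
Proof. by rewrite /tens !rmorph1 mulr1. Qed.

Lemma tens_linearl m n (b : {mpoly k[n]}) :
  linear (fun a : {mpoly k[m]} => a \ox b).
Proof. by move=> c a a'; rewrite /tens linearP mulrDl -scalerAl. Qed.

Lemma tens_linearr m n (a : {mpoly k[m]}) :
  linear (fun b : {mpoly k[n]} => a \ox b).
Proof. by move=> c b b'; rewrite /tens linearP mulrDr -scalerAr. Qed.

Lemma tensXX m n (mu : 'X_{1..(m + n)}) :
  'X_[lmon mu] \ox 'X_[rmon mu] = 'X_[mu] :> {mpoly k[m + n]}.
Proof.
rewrite /tens !comp_mpolyX [RHS]mpolyXE_id big_split_ord /=.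
by congr (_ * _); apply: eq_bigr => i _; rewrite tnth_mktuple mnmE.
Qed.

Lemma tens_ext m n (W : lmodType k) (F G : {linear {mpoly k[m + n]} -> W}) :
  (forall a b, F (a \ox b) = G (a \ox b)) -> F =1 G.
Proof.
move=> eqFG u; rewrite [u]mpolyE !linear_sum; apply: eq_bigr => mu _.
by rewrite !linearZ /= -tensXX eqFG.
Qed.

Lemma tliftE m n (W : lmodType k)
    (f : {mpoly k[m]} -> {mpoly k[n]} -> W) (u : {mpoly k[m + n]}) (N : nat) :
    (msize u <= N)%N ->
  tlift f u =
    \sum_(mu : 'X_{1..(m + n) < N}) u@_mu *: f 'X_[lmon mu] 'X_[rmon mu].
Proof.
move=> leuN; pose J : subFinType _ := 'X_{1..(m + n) < N}.
rewrite /tlift (ssrcomplements.big_mksub J) ?msupp_uniq //=; last first.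
  by move=> x /msize_mdeg_lt /leq_trans; apply.
by rewrite big_rmcond //= => mu /memN_msupp_eq0 ->; rewrite scale0r.
Qed.

Lemma tlift_linear m n (W : lmodType k)
  (f : {mpoly k[m]} -> {mpoly k[n]} -> W) : linear (tlift f).
Proof.
move=> c u v; pose N := maxn (msize (c *: u + v)) (maxn (msize u) (msize v)).
rewrite !(@tliftE _ _ _ f _ N) /N ?leq_max ?leqnn ?orbT //.
rewrite scaler_sumr -big_split; apply: eq_bigr => mu _ /=.
by rewrite mcoeffD mcoeffZ scalerDl scalerA.
Qed.

HB.instance Definition _ m n (W : lmodType k)
    (f : {mpoly k[m]} -> {mpoly k[n]} -> W) :=
  GRing.isLinear.Build k {mpoly k[m + n]} W *:%R (tlift f) (tlift_linear f).

Lemma tlift_tens m n (W : lmodType k) (f : {mpoly k[m]} -> {mpoly k[n]} -> W)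
    (a : {mpoly k[m]}) (b : {mpoly k[n]}) :
    (forall b', linear (fun a' => f a' b')) -> (forall a', linear (f a')) ->
  tlift f (a \ox b) = f a b.
Proof.
move=> linl linr.
pose fl b' : {linear {mpoly k[m]} -> W} :=
  HB.pack (fun a' => f a' b') (GRing.isLinear.Build _ _ _ _ _ (linl b')).
pose fr a' : {linear {mpoly k[n]} -> W} :=
  HB.pack (f a') (GRing.isLinear.Build _ _ _ _ _ (linr a')).
pose tl b' : {linear {mpoly k[m]} -> {mpoly k[m + n]}} :=
  HB.pack (fun a' => a' \ox b')
    (GRing.isLinear.Build _ _ _ _ _ (tens_linearl b')).
pose tr a' : {linear {mpoly k[n]} -> {mpoly k[m + n]}} :=
  HB.pack (fun b' => a' \ox b')
    (GRing.isLinear.Build _ _ _ _ _ (@tens_linearr m n a')).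
rewrite -[f a b]/(fl b a) -[a \ox b]/(tl b a) [a]mpolyE !linear_sum.
apply: eq_bigr => m1 _; rewrite !linearZ /=; congr (_ *: _).
rewrite -[f _ b]/(fr _ b) -[_ \ox b]/(tr _ b) [b]mpolyE !linear_sum.
apply: eq_bigr => m2 _; rewrite !linearZ /=; congr (_ *: _).
pose mu : 'X_{1..(m + n)} :=
  [multinom match split i with inl j => m1 j | inr j => m2 j end | i < m + n].
have -> : m1 = lmon mu.
  by apply/mnmP=> i; rewrite !mnmE (unsplitK (inl i)).
have -> : m2 = rmon mu.
  by apply/mnmP=> i; rewrite !mnmE (unsplitK (inr i)).
by rewrite tensXX /tlift msuppX big_seq1 mcoeffX eqxx scale1r.
Qed.

End Tensor.

Arguments tswap {k m n}.
Arguments tassoc {k m n p}.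

Notation "a \ox b" := (tens a b) : ring_scope.

Section PolynomialHopfAlgebra.
Variables (k : fieldType) (d : nat).

Local Notation A := {mpoly k[d]}.
Local Notation A2 := {mpoly k[d + d]}.
Local Notation A3 := {mpoly k[d + d + d]}.

Definition comult (a : A) : A2 :=
  a \mPo [tuple 'X_i \ox 1 + 1 \ox 'X_i | i < d].

(* v1 (x) v2 |-> v2 (x) v1 *)
Definition t2 : A2 -> A2 := tswap.

(* v1 (x) v2 (x) v3 |-> v3 (x) v1 (x) v2 *)
Definition t3 (u : A3) : A3 := tassoc (tswap u).

Record is_coPoissonHopf (q : A -> A2) : Prop := CoPoissonHopf {
  coPoisson_skew : forall a, q a + t2 (q a) = 0;
  coPoisson_jacobi : forall a,
    let w := tmap q id (q a) in w + t3 w + t3 (t3 w) = 0;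
  coPoisson_coLeibniz : forall a,
    tmap comult id (q a) =
      tassoc (tmap id q (comult a)) - t3 (t3 (tmap q id (comult a)));
  coPoisson_deriv : forall a b,
    q (a * b) = q a * comult b + comult a * q b
}.

(* Sweedler's \sum f(a_1) g(a_2), products being taken in A (x) A. *)
Definition sweedler_mul (f g : A -> A2) (a : A) : A2 :=
  tlift (fun a1 a2 => f a1 * g a2) (comult a).

Definition in_calI (u : A2) : Prop :=
  exists c : 'I_d -> 'I_d -> k,
    u = \sum_(i < d) \sum_(j < d | (i < j)%N)
          c i j *: ('X_i \ox 'X_j - 'X_j \ox 'X_i).

Lemma t2_tens (a b : A) : t2 (a \ox b) = b \ox a.
Proof.
by rewrite /t2 /tswap tlift_tens //; [exact: tens_linearr | exact: tens_linearl].
Qed.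

Lemma tassoc_tens m n p (a : {mpoly k[m]}) (b : {mpoly k[n]})
  (c : {mpoly k[p]}) : tassoc (a \ox (b \ox c)) = a \ox b \ox c.
Proof.
rewrite /tassoc tlift_tens.
- rewrite tlift_tens // => [c' x b1 b2|a' x c1 c2].
  + by rewrite tens_linearr tens_linearl.
  + by rewrite tens_linearr.
- move=> w x a1 a2; rewrite /tlift scaler_sumr -big_split /=.
  apply: eq_bigr => mu _.
  by rewrite !tens_linearl scalerDr !scalerA mulrC.
- by move=> a'; exact: linearP.
Qed.

Lemma t3_tens (a b c : A) : t3 (a \ox b \ox c) = c \ox a \ox b.
Proof.
rewrite /t3 /tswap tlift_tens ?tassoc_tens //.
- by move=> ?; exact: tens_linearr.
- by move=> ?; exact: tens_linearl.
Qed.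

Lemma tmap_tens m n m' n' (f : {linear {mpoly k[m]} -> {mpoly k[m']}})
    (g : {linear {mpoly k[n]} -> {mpoly k[n']}}) a b :
  tmap f g (a \ox b) = f a \ox g b.
Proof.
rewrite /tmap tlift_tens // => [b' x a1 a2|a' x b1 b2].
- by rewrite linearP tens_linearl.
- by rewrite linearP tens_linearr.
Qed.

End PolynomialHopfAlgebra.

(* Main.v *)
Require Import Defs.
From mathcomp Require Import all_boot all_algebra.
From HB Require Import structures.
From mathcomp Require Import ring.

(** Write Delta for the comultiplication of A = k[x_1..x_d] and Delta3 for
   its iterate A -> A (x) A (x) A; both are algebra morphisms.  The idea is
   that everything in sight is a derivation along one of these morphisms,
   that is, a linear F with F(ab) = F(a) phi(b) + phi(a) F(b), and two such
   derivations agree as soon as they agree on x_1, .., x_d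
   ([derivation_along_eq]).

   If I vanishes on every monomial other than x_1, .., x_d, then I is a
   derivation along the counit, so a |-> sum I(a_1) Delta(a_2) is the
   derivation along Delta that extends x_s |-> I(x_s)
   ([sweedler_mul_derivation]).  The formula for q on monomials, with this
   vanishing of I, therefore says exactly that q is a derivation along Delta
   with q(x_s) = I(x_s).

   For such a q, the defects of skew-symmetry, of the co-Leibniz rule and,
   given the co-Leibniz rule, of the co-Jacobi identity are derivations
   along Delta or Delta3 ([skew_of_gens], [coLeibniz_of_gens],
   [jacobi_of_gens]), so each axiom has to be checked on the x_s only.  When
   q(x_s) = sum lambda_s^ij x_i (x) x_j with lambda_s skew-symmetric, the
   first two hold, and the co-Jacobi expression of x_s is a combination of
   the x_i (x) x_j (x) x_m whose coefficients are the quadratic expressions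
   in lambda ([jacobiator_bivector]).  When the lambda_s also have zero
   diagonal, these alternate in i, j, m, so it is enough that they vanish
   for i < j < m ([jacobiator_eq0]).

   What remains is to show that in characteristic 0 a co-Poisson structure
   has q(x_s) bilinear in the generators.  Put u = q(x_s).  Multiplying the
   first two factors in the co-Leibniz rule for x_s gives (D (x) 1)(u) = 2u,
   where D multiplies a monomial of degree n by 2^n.  Hence a monomial of u
   with left degree n has 2^n = 2, so n = 1, and by skew-symmetry the right
   degree is 1 as well ([bivector_of_coLeibniz]). *)

Set Implicit Arguments.
Unset Strict Implicit.
Unset Printing Implicit Defensive.

Import GRing.Theory.
Local Open Scope ring_scope.

(** * Derivations along a morphism, and cyclic sums *)

(** [F] is a derivation for the bimodule structure that [phi] puts on [S]. *)
Definition derivation_along (R S : pzSemiRingType) (phi F : R -> S) :=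
  forall a b, F (a * b) = F a * phi b + phi a * F b.

Lemma derivation_along1 (R : pzSemiRingType) (S : pzRingType) (phi F : R -> S) :
  phi 1 = 1 -> derivation_along phi F -> F 1 = 0.
Proof.
move=> phi1 derF; apply: (addrI (F 1)).
by rewrite addr0 -{3}[1]mulr1 derF phi1 mulr1 mul1r.
Qed.

Section CyclicSums.

Lemma cyclic_sum_fixed (V : zmodType) (t : {additive V -> V}) (a b c : V) :
  t a = b -> t b = c -> t c = a -> t (a + b + c) = a + b + c.
Proof. by move=> ta tb tc; rewrite 2!raddfD /= ta tb tc addrC addrA. Qed.

(* In the application, t rotates the factors of A (x) A (x) A, and D, D' are
   values of Delta3, which t fixes. *)
Variables (S : comPzRingType) (t : {additive S -> S}).
Hypothesis tM : {morph t : x y / x * y}.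

(** The product rule for [t r - t (t r)], the right-hand side of the co-Leibniz
   rule. *)
Lemma coboundary_derivation (r r' D D' : S) : t D = D -> t D' = D' ->
  t (r * D' + D * r') - t (t (r * D' + D * r')) =
  (t r - t (t r)) * D' + D * (t r' - t (t r')).
Proof.
move=> tD tD'; rewrite !(raddfD t, tM, tD, tD'); ring.
Qed.

(** The product rule for the co-Jacobi expression: in the cyclic sum, the
   mixed terms in [r], [r'] cancel in pairs. *)
Lemma cyclic_sum_derivation (w w' r r' D D' : S) :
    t (t (t r)) = r -> t (t (t r')) = r' -> t D = D -> t D' = D' ->
  let x := w * D' + (t r - t (t r)) * r'
           + (r * (t r' - t (t r')) + D * w') in
  x + t x + t (t x) =
  (w + t w + t (t w)) * D' + D * (w' + t w' + t (t w')).
Proof.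
move=> tr tr' tD tD' /=.
rewrite !(raddfD t, raddfN t, tM, tD, tD', tr, tr'); ring.
Qed.

End CyclicSums.

(** * Linear maps on polynomials determined by the generators *)

Lemma multinom_ind n (P : 'X_{1..n} -> Prop) :
  P 0%MM -> (forall i m, P m -> P (U_(i) + m)%MM) -> forall m, P m.
Proof.
move=> P0 PU m; have [N] := ubnP (mdeg m); elim: N m => // N IH m ltmN.
have [/eqP|nz] := eqVneq (mdeg m) 0%N.
  by rewrite mdeg_eq0 => /eqP ->.
have /existsP[i nzi] : [exists i, m i != 0%N].
  rewrite -negb_forall; apply: contraNN nz => /forallP m0.
  by rewrite mdegE big1 // => i _; apply/eqP/m0.
have leU : (U_(i) <= m)%MM by rewrite lep1mP.
rewrite -(submK leU) addmC; apply: PU; apply: IH.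
move: ltmN; rewrite -{1}(submK leU) mdegD mdeg1 addn1 ltnS; exact.
Qed.

Section Extensionality.
Variables (k : fieldType) (n : nat).

Lemma mpoly_lin_ext (W : lmodType k) (F G : {linear {mpoly k[n]} -> W}) :
  (forall m, F 'X_[m] = G 'X_[m]) -> F =1 G.
Proof.
move=> eqFG u; rewrite [u]mpolyE !linear_sum; apply: eq_bigr => m _.
by rewrite !linearZ /= eqFG.
Qed.

Lemma derivation_along_eq (B : algType k) (phi : {mpoly k[n]} -> B)
    (F G : {linear {mpoly k[n]} -> B}) :
    phi 1 = 1 -> derivation_along phi F -> derivation_along phi G ->
  (forall i, F 'X_i = G 'X_i) -> F =1 G.
Proof.
move=> phi1 derF derG eqFG; apply: mpoly_lin_ext;
  elim/multinom_ind => [|i m IH].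
  by rewrite mpolyX0 !(derivation_along1 phi1).
by rewrite mpolyXD derF derG IH eqFG.
Qed.

Lemma multiplicative_eq (B : algType k) (F G : {linear {mpoly k[n]} -> B}) :
    {morph F : x y / x * y} -> {morph G : x y / x * y} ->
  F 1 = G 1 -> (forall i, F 'X_i = G 'X_i) -> F =1 G.
Proof.
move=> FM GM eq1 eqX; apply: mpoly_lin_ext; elim/multinom_ind => [|i m IH].
  by rewrite mpolyX0.
by rewrite mpolyXD FM GM IH eqX.
Qed.

End Extensionality.

(** * Multiplicativity of maps on tensor products *)

Section TensorMaps.
Variable k : fieldType.

Lemma tlift_X m n (W : lmodType k)
    (f : {mpoly k[m]} -> {mpoly k[n]} -> W) (mu : 'X_{1..(m + n)}) :
  tlift f 'X_[mu] = f 'X_[lmon mu] 'X_[rmon mu].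
Proof. by rewrite /tlift msuppX big_seq1 mcoeffX eqxx scale1r. Qed.

Lemma lmonD m n (mu nu : 'X_{1..(m + n)}) : lmon (mu + nu)
  = (lmon mu + lmon nu)%MM.
Proof. by apply/mnmP => i; rewrite !mnmE. Qed.

Lemma rmonD m n (mu nu : 'X_{1..(m + n)}) : rmon (mu + nu)
  = (rmon mu + rmon nu)%MM.
Proof. by apply/mnmP => i; rewrite !mnmE. Qed.

(** Three functions rather than one, so that the lemma also applies to the
   inner [tlift] of [tassoc], whose integrand depends on an outer variable. *)
Lemma tlift_mul m n (B : algType k)
    (f f' g : {mpoly k[m]} -> {mpoly k[n]} -> B) :
    (forall a a' b b', g (a * a') (b * b') = f a b * f' a' b') ->
  forall u v, tlift g (u * v) = tlift f u * tlift f' v.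
Proof.
move=> gM u v; elim/mpolyind: u => [|c mu u _ _ IHu].
  by rewrite mul0r !linear0 mul0r.
rewrite mulrDl -scalerAl !linearP /= mulrDl -scalerAl IHu.
congr (_ *: _ + _) => {IHu u}.
elim/mpolyind: v => [|e nu v _ _ IHv]; first by rewrite mulr0 !linear0 mulr0.
rewrite mulrDr -scalerAr !linearP /= mulrDr -scalerAr IHv; congr (_ *: _ + _).
by rewrite -mpolyXD !tlift_X lmonD rmonD !mpolyXD gM.
Qed.

Lemma tlift_derivation m n (B : algType k)
    (e f : {mpoly k[m]} -> {mpoly k[n]} -> B) :
    (forall a a' b b', f (a * a') (b * b')
      = f a b * e a' b' + e a b * f a' b') ->
  derivation_along (tlift e) (tlift f).
Proof.
move=> fD u v; elim/mpolyind: u => [|c mu u _ _ IHu].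
  by rewrite mul0r !linear0 !mul0r addr0.
rewrite mulrDl -scalerAl !linearP /= !mulrDl -!scalerAl IHu.
rewrite addrACA -scalerDr; congr (_ *: _ + _) => {IHu u}.
elim/mpolyind: v => [|x nu v _ _ IHv].
  by rewrite mulr0 !linear0 !mulr0 addr0.
rewrite mulrDr -scalerAr !linearP /= !mulrDr -!scalerAr IHv.
rewrite addrACA -scalerDr; congr (_ *: _ + _).
by rewrite -mpolyXD !tlift_X lmonD rmonD !mpolyXD fD.
Qed.

HB.instance Definition _ m n m' n'
    (f : {mpoly k[m]} -> {mpoly k[m']}) (g : {mpoly k[n]} -> {mpoly k[n']}) :=
  GRing.Linear.copy (tmap f g) (tlift (fun a b => f a \ox g b)).

HB.instance Definition _ m n :=
  GRing.Linear.copy (@tswap k m n) (tlift (fun a b => b \ox a)).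

HB.instance Definition _ m n p :=
  GRing.Linear.copy (@tassoc k m n p)
    (tlift (fun a => tlift (fun b c => a \ox b \ox c))).

HB.instance Definition _ d := GRing.Linear.copy (@t2 k d) (@tswap k d d).

HB.instance Definition _ d :=
  GRing.Linear.copy (@t3 k d) (@tassoc k d d d \o @tswap k (d + d) d).

HB.instance Definition _ d :=
  GRing.Linear.copy (@comult k d)
    (comp_mpoly [tuple ('X_i : {mpoly k[d]}) \ox 1 + 1 \ox 'X_i | i < d]).

HB.instance Definition _ d :=
  GRing.RMorphism.copy (@comult k d)
    (comp_mpoly [tuple ('X_i : {mpoly k[d]}) \ox 1 + 1 \ox 'X_i | i < d]).

Lemma tens0l m n (b : {mpoly k[n]}) : (0 : {mpoly k[m]}) \ox b = 0.
Proof. by rewrite /tens rmorph0 mul0r. Qed.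

Lemma tensDl m n (a a' : {mpoly k[m]}) (b : {mpoly k[n]}) :
  (a + a') \ox b = a \ox b + a' \ox b.
Proof. by rewrite /tens rmorphD mulrDl. Qed.

Lemma tensDr m n (a : {mpoly k[m]}) (b b' : {mpoly k[n]}) :
  a \ox (b + b') = a \ox b + a \ox b'.
Proof. by rewrite /tens rmorphD mulrDr. Qed.

Lemma tensZl m n c (a : {mpoly k[m]}) (b : {mpoly k[n]}) :
  (c *: a) \ox b = c *: (a \ox b).
Proof. by rewrite /tens linearZ /= -scalerAl. Qed.

Lemma tensZr m n c (a : {mpoly k[m]}) (b : {mpoly k[n]}) :
  a \ox (c *: b) = c *: (a \ox b).
Proof. by rewrite /tens linearZ /= -scalerAr. Qed.

Lemma tens_suml m n I (r : seq I) (P : pred I)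
  (F : I -> {mpoly k[m]}) (b : {mpoly k[n]}) :
  (\sum_(i <- r | P i) F i) \ox b = \sum_(i <- r | P i) F i \ox b.
Proof. by rewrite /tens linear_sum mulr_suml. Qed.

Lemma tens3_ext m n p (W : lmodType k)
    (F G : {linear {mpoly k[m + n + p]} -> W}) :
  (forall a b c, F (a \ox b \ox c) = G (a \ox b \ox c)) -> F =1 G.
Proof.
move=> eqFG; apply: tens_ext => u c.
rewrite [u]mpolyE !tens_suml !linear_sum; apply: eq_bigr => mu _.
by rewrite !tensZl !linearZ /= -tensXX eqFG.
Qed.

Lemma tmapM m n m' n' (f : {mpoly k[m]} -> {mpoly k[m']})
    (g : {mpoly k[n]} -> {mpoly k[n']}) :
    {morph f : x y / x * y} -> {morph g : x y / x * y} ->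
  {morph tmap f g : u v / u * v}.
Proof.
by move=> fM gM; apply: tlift_mul => a a' b b'; rewrite fM gM tensM.
Qed.

Lemma tmap_derivation m n m' n' (e f : {mpoly k[m]} -> {mpoly k[m']})
    (g : {mpoly k[n]} -> {mpoly k[n']}) :
    derivation_along e f -> {morph g : x y / x * y} ->
  derivation_along (tmap e g) (tmap f g).
Proof.
move=> fD gM; apply: tlift_derivation => a a' b b'.
by rewrite fD gM tensDl !tensM.
Qed.

Lemma tswapM m n : {morph @tswap k m n : u v / u * v}.
Proof. by apply: tlift_mul => a a' b b'; rewrite tensM. Qed.

Lemma tassocM m n p : {morph @tassoc k m n p : u v / u * v}.
Proof.
apply: tlift_mul => a a' u u'; apply: tlift_mul => b b' c c'.
by rewrite !tensM.
Qed.

Lemma tmap_idr m n m' (f : {linear {mpoly k[m]} -> {mpoly k[m']}})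
    (a : {mpoly k[m]}) (b : {mpoly k[n]}) : tmap f id (a \ox b) = f a \ox b.
Proof. exact: (tmap_tens f idfun). Qed.

Lemma tmap_idl m n n' (g : {linear {mpoly k[n]} -> {mpoly k[n']}})
    (a : {mpoly k[m]}) (b : {mpoly k[n]}) : tmap id g (a \ox b) = a \ox g b.
Proof. exact: (tmap_tens idfun g). Qed.

Lemma tswap_tens m n (a : {mpoly k[m]}) (b : {mpoly k[n]}) :
  tswap (a \ox b) = b \ox a.
Proof.
by rewrite /tswap tlift_tens // => ?; [apply: tens_linearr | apply:
  tens_linearl].
Qed.

(** * Rotations and iterated comultiplication *)

Variable d : nat.
Local Notation A := {mpoly k[d]}.
Local Notation A2 := {mpoly k[d + d]}.
Local Notation A3 := {mpoly k[d + d + d]}.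

Lemma t3M : {morph @t3 k d : u v / u * v}.
Proof. by move=> u v; rewrite /t3 tswapM tassocM. Qed.

Lemma t2M : {morph @t2 k d : u v / u * v}.
Proof. exact: tswapM. Qed.

Lemma t3K (u : A3) : t3 (t3 (t3 u)) = u.
Proof.
have t3t a b c : t3 (t3 (t3 (a \ox b \ox c))) = a \ox b \ox c :> A3.
  by rewrite !t3_tens.
exact: (tens3_ext (F := @t3 k d \o @t3 k d \o @t3 k d) (G := idfun) t3t).
Qed.

Lemma comultX i : comult ('X_i : A) = 'X_i \ox 1 + 1 \ox 'X_i.
Proof. by rewrite /comult comp_mpolyXU -tnth_nth tnth_mktuple. Qed.

Lemma comult_cocomm (a : A) : tswap (comult a) = comult a.
Proof.
apply: (multiplicative_eq (F := @tswap k d d \o @comult k d)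
  (G := @comult k d)) a.
- by move=> a b; rewrite /= rmorphM tswapM.
- exact: rmorphM.
- by rewrite /= rmorph1 -tens11 tswap_tens.
- by move=> i; rewrite /= comultX linearD /= !tswap_tens addrC.
Qed.

(** Delta3 = (Delta (x) 1) Delta. *)
Definition comult3 (a : A) : A3 := tmap (@comult k d) id (comult a).

HB.instance Definition _ :=
  GRing.Linear.copy comult3 (tmap (@comult k d) id \o @comult k d).

Lemma comult3M : {morph comult3 : a b / a * b}.
Proof. by move=> a b; rewrite /comult3 rmorphM tmapM //; exact: rmorphM. Qed.

Lemma comult3_1 : comult3 1 = 1.
Proof. by rewrite /comult3 rmorph1 -tens11 tmap_idr rmorph1 !tens11. Qed.

Lemma comult3X i : comult3 'X_i = 'X_i \ox 1 \ox 1 + 1 \ox 'X_i \ox 1 + 1 \ox 1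
  \ox 'X_i.
Proof.
by rewrite /comult3 comultX linearD /= !tmap_idr /= comultX rmorph1 tensDl
  -tens11.
Qed.

Lemma t3_comult3 a : t3 (comult3 a) = comult3 a.
Proof.
apply: (multiplicative_eq (F := @t3 k d \o comult3) (G := comult3)) a.
- by move=> a b; rewrite /= comult3M t3M.
- exact: comult3M.
- by rewrite /= comult3_1 -!tens11 t3_tens.
- by move=> i; rewrite /= comult3X; apply: cyclic_sum_fixed; exact: t3_tens.
Qed.

(** With [comult_cocomm], this puts both sides of the co-Leibniz rule in terms
   of (q (x) 1) Delta. *)
Lemma t3_tmap_l (q : {linear A -> A2}) (u : A2) :
  t3 (tmap q id u) = tassoc (tmap id q (tswap u)).
Proof.
have eqt a b : t3 (tmap q id (a \ox b)) = tassoc (tmap id q (tswap (a \ox b)))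
  :> A3.
  by rewrite tmap_idr tswap_tens tmap_idl /t3 tswap_tens.
exact: (tens_ext (F := @t3 k d \o tmap q id)
  (G := @tassoc k d d d \o tmap id q \o @tswap k d d) eqt).
Qed.

End TensorMaps.

(** * The co-Poisson axioms reduce to the generators *)

Section ReductionToGenerators.
Variables (k : fieldType) (d : nat).
Local Notation A := {mpoly k[d]}.
Local Notation A2 := {mpoly k[d + d]}.
Local Notation A3 := {mpoly k[d + d + d]}.

Variable q : {linear A -> A2}.
Hypothesis qD : derivation_along (@comult k d) q.

(* R and w are (q (x) 1) Delta and (q (x) 1) q, and D1 is the left-hand side
   (Delta (x) 1) q of the co-Leibniz rule. *)
Let R (a : A) : A3 := tmap q id (comult a).
Let w (a : A) : A3 := tmap q id (q a).
Let D1 (a : A) : A3 := tmap (@comult k d) id (q a).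

Let idM : {morph (id : A -> A) : x y / x * y}. Proof. by []. Qed.

Let tqD : derivation_along (tmap (@comult k d) id) (tmap q (id : A -> A)).
Proof. exact: tmap_derivation. Qed.

Let RD : derivation_along (@comult3 k d) R.
Proof. by move=> a b; rewrite /R rmorphM tqD. Qed.

Let D1D : derivation_along (@comult3 k d) D1.
Proof. by move=> a b; rewrite /D1 qD linearD /= !(tmapM (rmorphM (@comult k d))
  idM). Qed.

Lemma coLeibnizE a :
  tassoc (tmap id q (comult a)) - t3 (t3 (tmap q id (comult a)))
  = t3 (R a) - t3 (t3 (R a)).
Proof. by rewrite /R t3_tmap_l comult_cocomm. Qed.

Lemma skew_of_gens :
  (forall s, t2 (q 'X_s) = - q 'X_s) -> forall a, q a + t2 (q a) = 0.
Proof.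
move=> skX a.
apply: (derivation_along_eq (phi := @comult k d) (F := q \+ (@t2 k d \o q))
  (G := \0)).
- exact: rmorph1.
- have t2c b : t2 (comult b) = comult b by exact: comult_cocomm.
  move=> b c; rewrite /= qD linearD /= !t2M !t2c mulrDl mulrDr.
  exact: addrACA.
- by move=> b c; rewrite /= mul0r mulr0 addr0.
- by move=> s; rewrite /= skX subrr.
Qed.

Lemma coLeibniz_of_gens :
    (forall s, D1 'X_s = t3 (R 'X_s) - t3 (t3 (R 'X_s))) ->
  forall a, D1 a = t3 (R a) - t3 (t3 (R a)).
Proof.
move=> cLX a.
pose F : {linear A -> A3} := tmap (@comult k d) id \o q.
pose R' : {linear A -> A3} := tmap q id \o @comult k d.
pose G : {linear A -> A3} := (@t3 k d \o R') \- (@t3 k d \o (@t3 k d \o R')).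
apply: (derivation_along_eq (phi := @comult3 k d) (F := F) (G := G)).
- exact: comult3_1.
- exact: D1D.
- move=> b c; change (t3 (R (b * c)) - t3 (t3 (R (b * c))) =
    (t3 (R b) - t3 (t3 (R b))) * comult3 c + comult3 b * (t3 (R c) - t3 (t3 (R
      c)))).
  by rewrite RD; apply: coboundary_derivation (@t3M k d) _ _ _ _ _ _;
    exact: t3_comult3.
- exact: cLX.
Qed.

Lemma jacobi_of_gens :
    (forall a, D1 a = t3 (R a) - t3 (t3 (R a))) ->
    (forall s, w 'X_s + t3 (w 'X_s) + t3 (t3 (w 'X_s)) = 0) ->
  forall a, w a + t3 (w a) + t3 (t3 (w a)) = 0.
Proof.
move=> cL jX a.
pose W : {linear A -> A3} := tmap q id \o q.
pose F : {linear A -> A3} := W \+ (@t3 k d \o W) \+ (@t3 k d \o (@t3 k d \o W)).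
apply: (derivation_along_eq (phi := @comult3 k d) (F := F) (G := \0)).
- exact: comult3_1.
- move=> b c; change (w (b * c) + t3 (w (b * c)) + t3 (t3 (w (b * c))) =
    (w b + t3 (w b) + t3 (t3 (w b))) * comult3 c
    + comult3 b * (w c + t3 (w c) + t3 (t3 (w c)))).
  have -> : w (b * c) = w b * comult3 c + D1 b * R c + (R b * D1 c + comult3 b
    * w c).
    by rewrite /w qD linearD /= !tqD.
  rewrite !cL; apply: cyclic_sum_derivation (@t3M k d) _ _ _ _ _ _ _ _ _ _.
  - exact: t3K.
  - exact: t3K.
  - exact: t3_comult3.
  - exact: t3_comult3.
- by move=> b c; rewrite /= mul0r mulr0 addr0.
- exact: jX.
Qed.

End ReductionToGenerators.

(** * Convolution products with the comultiplication *)

Section Sweedler.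
Variables (k : fieldType) (d : nat).
Local Notation A := {mpoly k[d]}.
Local Notation A2 := {mpoly k[d + d]}.

(** A derivation along the counit, which is the constant coefficient. *)
Definition counit_derivation (W : lmodType k) (f : A -> W) :=
  forall a b, f (a * b) = b@_0%MM *: f a + a@_0%MM *: f b.

Lemma mcoeff0M (a b : A) : (a * b)@_0%MM = a@_0%MM * b@_0%MM.
Proof. exact: rmorphM (mcoeff 0%MM) a b. Qed.

Lemma mcoeffU_mul (a b : A) i :
  (a * b)@_U_(i) = b@_0%MM * a@_U_(i) + a@_0%MM * b@_U_(i).
Proof.
have mcoeffU_deriv (c : A) : c@_U_(i) = c^`M(i)@_0%MM.
  by rewrite mcoeff_deriv add0m mnm0E mulr1n.
by rewrite !mcoeffU_deriv mderivM mcoeffD !mcoeff0M mulrC.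
Qed.

(** The counit axiom, composed with Delta. *)
Lemma comult_counit (a : A) :
  tlift (fun a1 a2 : A => a1@_0%MM *: comult a2) (comult a) = comult a.
Proof.
pose e (a1 a2 : A) : A2 := a1@_0%MM *: comult a2.
have e_tens a1 a2 : tlift e (a1 \ox a2) = a1@_0%MM *: comult a2.
  apply: tlift_tens => [b x b1 b2|b x b1 b2]; rewrite /e.
    by rewrite mcoeffD mcoeffZ scalerDl scalerA.
  by rewrite linearP scalerDr !scalerA mulrC.
apply: (multiplicative_eq (F := tlift e \o @comult k d) (G := @comult k d)) a.
- move=> a b; rewrite /= rmorphM; apply: tlift_mul => a1 a2 b1 b2.
  by rewrite /e mcoeff0M rmorphM -scalerAl -scalerAr scalerA.
- exact: rmorphM.
- by rewrite /= {1}rmorph1 -tens11 e_tens mcoeff1 eqxx scale1r.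
- move=> i; rewrite /= {1}comultX linearD /= !e_tens mcoeff1 eqxx scale1r.
  by rewrite mcoeffX mnm1_eq0 scale0r add0r.
Qed.

Lemma sweedler_mul_derivation (I : A -> A2) :
  counit_derivation I ->
  derivation_along (@comult k d) (sweedler_mul I (@comult k d)).
Proof.
move=> ID a b; rewrite /sweedler_mul rmorphM.
rewrite (tlift_derivation (e := fun a1 a2 : A => a1@_0%MM *: comult a2)).
  by rewrite !comult_counit.
move=> a1 a2 b1 b2.
rewrite ID rmorphM mulrDl -!scalerAl -!scalerAr mulrA.
by rewrite /= [I a2 * (_ * _)]mulrCA.
Qed.

Lemma sweedler_mulX (I : {linear A -> A2}) i :
  I 1 = 0 -> sweedler_mul I (@comult k d) 'X_i = I 'X_i.
Proof.
move=> I1; rewrite /sweedler_mul comultX linearD /= !tlift_tens.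
- by rewrite I1 mul0r addr0 rmorph1 mulr1.
- by move=> b x b1 b2; rewrite linearP mulrDl scalerAl.
- by move=> b x b1 b2; rewrite linearP mulrDr scalerAr.
- by move=> b x b1 b2; rewrite linearP mulrDl scalerAl.
- by move=> b x b1 b2; rewrite linearP mulrDr scalerAr.
Qed.

(** The linear map sending ['X_s] to [v s] and all other monomials to 0. *)
Definition linear_part (W : lmodType k) (v : 'I_d -> W) (a : A) : W :=
  \sum_s a@_U_(s) *: v s.

Lemma linear_part_linear (W : lmodType k) (v : 'I_d ->
  W) : linear (linear_part v).
Proof.
move=> c a b; rewrite /linear_part scaler_sumr -big_split;
  apply: eq_bigr => s _.
by rewrite mcoeffD mcoeffZ scalerDl scalerA.
Qed.

HB.instance Definition _ (W : lmodType k) (v : 'I_d -> W) :=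
  GRing.isLinear.Build k A W *:%R (linear_part v) (linear_part_linear v).

Lemma linear_partX (W : lmodType k) (v : 'I_d ->
  W) s : linear_part v 'X_s = v s.
Proof.
rewrite /linear_part (bigD1 s) //= mcoeffXU eqxx scale1r big1 ?addr0 // => i ni.
by rewrite mcoeffXU eq_sym (negbTE ni) scale0r.
Qed.

Lemma linear_part_other (W : lmodType k) (v : 'I_d -> W) (m : 'X_{1..d}) :
  (forall s, m != U_(s)%MM) -> linear_part v 'X_[m] = 0.
Proof.
by move=> ne; rewrite /linear_part big1 // => s _;
  rewrite mcoeffX (negbTE (ne s)) scale0r.
Qed.

Lemma linear_part_counit (W : lmodType k) (v : 'I_d -> W) :
  counit_derivation (linear_part v).
Proof.
move=> a b; rewrite /linear_part !scaler_sumr -big_split; apply: eq_bigr => s _.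
by rewrite mcoeffU_mul scalerDl !scalerA.
Qed.

Lemma linear_part1 (W : lmodType k) (v : 'I_d -> W) : linear_part v 1 = 0.
Proof.
by rewrite -mpolyX0 linear_part_other // => s; rewrite eq_sym mnm1_eq0.
Qed.

Lemma mpolyX_neq (m : 'X_{1..d}) s : ('X_[m] != 'X_s :> A) = (m != U_(s)%MM).
Proof.
apply/idP/idP; apply: contraNN => /eqP e; first by rewrite e.
have := congr1 (mcoeff m) e; rewrite !mcoeffX eqxx eq_sym.
by case: eqP => // _ /eqP; rewrite oner_eq0.
Qed.

Lemma linear_part_unique (W : lmodType k) (I : {linear A -> W}) :
    (forall m : 'X_{1..d}, (forall s, 'X_[m] != 'X_s :> A) -> I 'X_[m] = 0) ->
  I =1 linear_part (fun s => I 'X_s).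
Proof.
move=> I0; apply: mpoly_lin_ext => m.
case: (boolP [exists s, m == U_(s)%MM]) => [/existsP[s /eqP ->]|].
  by rewrite /= linear_partX.
rewrite negb_exists => /forallP ne; rewrite /= linear_part_other // I0 // => s.
by rewrite mpolyX_neq.
Qed.

Lemma derivation_sweedler (q I : {linear A -> A2}) :
    (forall m : 'X_{1..d}, (forall s, 'X_[m] != 'X_s :> A) -> I 'X_[m] = 0) ->
    (forall m : 'X_{1..d}, q 'X_[m] = sweedler_mul I (@comult k d) 'X_[m]) ->
  derivation_along (@comult k d) q /\ forall s, q 'X_s = I 'X_s.
Proof.
move=> I0 qI; have IE := linear_part_unique I0.
have qE a : q a = sweedler_mul I (@comult k d) a.
  pose f (a1 a2 : A) := I a1 * comult a2.
  exact: (mpoly_lin_ext (F := q) (G := tlift f \o @comult k d) qI).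
have ID : counit_derivation I by move=> a b; rewrite !IE linear_part_counit.
split=> [a b|s]; first by rewrite !qE sweedler_mul_derivation.
by rewrite qE sweedler_mulX // IE linear_part1.
Qed.

Lemma sweedler_derivation (q : {linear A -> A2}) (a : A) :
    derivation_along (@comult k d) q ->
  q a = sweedler_mul (linear_part (fun s => q 'X_s)) (@comult k d) a.
Proof.
move=> qD; pose I := linear_part (fun s => q 'X_s).
pose f (a1 a2 : A) := I a1 * comult a2.
apply: (derivation_along_eq (phi := @comult k d) (F := q)
  (G := tlift f \o @comult k d)) => //.
- exact: rmorph1.
- exact: (sweedler_mul_derivation (linear_part_counit _)).
- move=> s; have := @sweedler_mulX I s (linear_part1 _).
  by rewrite /sweedler_mul /= linear_partX => ->.
Qed.

End Sweedler.

(** * Bivectors and trivectors *)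

Section SumExchange.
Variables (V : nmodType) (I : finType).

Lemma sum3_rot (F : I -> I -> I -> V) :
  \sum_i \sum_j \sum_l F i j l = \sum_i \sum_j \sum_l F j l i.
Proof.
under eq_bigr => i _ do rewrite exchange_big /=.
by rewrite exchange_big.
Qed.

Lemma sum4_rev (F : I -> I -> I -> I -> V) :
  \sum_l \sum_m \sum_i \sum_j F l m i j = \sum_i \sum_j \sum_m \sum_l F l m i j.
Proof.
under eq_bigr => l _ do rewrite sum3_rot sum3_rot.
rewrite exchange_big; apply: eq_bigr => i _.
by rewrite sum3_rot; apply: eq_bigr => j _; rewrite exchange_big.
Qed.

End SumExchange.

Section Bivectors.
Variables (k : fieldType) (d : nat).
Local Notation A := {mpoly k[d]}.
Local Notation A2 := {mpoly k[d + d]}.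
Local Notation A3 := {mpoly k[d + d + d]}.

(** The element of A (x) A that is bilinear in the generators, with
   coefficient matrix [L]. *)
Definition bivector (L : 'M[k]_d) : A2 := \sum_i \sum_j L i j *: ('X_i \ox
  'X_j).

(** The linear functional extracting the coefficient of ['X_i \ox 'X_j]; it
   takes values in [k^o], so that [tlift] applies. *)
Definition coef2 (i j : 'I_d) : A2 -> k^o :=
  tlift (fun a b : A => (a@_U_(i) * b@_U_(j) : k^o)).
HB.instance Definition _ i j := GRing.Linear.copy (coef2 i j)
  (tlift (fun a b : A => (a@_U_(i) * b@_U_(j) : k^o))).

Lemma coef2_tens i j (a b : A) : coef2 i j (a \ox b) = a@_U_(i) * b@_U_(j).
Proof.
rewrite /coef2 tlift_tens // => [b' x a1 a2|a' x b1 b2].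
- by rewrite mcoeffD mcoeffZ mulrDl -mulrA.
- by rewrite mcoeffD mcoeffZ mulrDr mulrCA.
Qed.

(** The same for ['X_i \ox 'X_j \ox 'X_l]. *)
Definition coef3 (i j l : 'I_d) : A3 -> k^o :=
  tlift (fun (u : A2) (c : A) => (coef2 i j u * c@_U_(l) : k^o)).
HB.instance Definition _ i j l := GRing.Linear.copy (coef3 i j l)
  (tlift (fun (u : A2) (c : A) => (coef2 i j u * c@_U_(l) : k^o))).

Lemma coef3_tens i j l (a b c : A) :
  coef3 i j l (a \ox b \ox c) = a@_U_(i) * b@_U_(j) * c@_U_(l).
Proof.
rewrite /coef3 tlift_tens ?coef2_tens // => [b' x a1 a2|a' x b1 b2].
- by rewrite linearP /= mulrDl -mulrA.
- by rewrite mcoeffD mcoeffZ mulrDr mulrCA.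
Qed.

Lemma sum_delta (T : 'I_d -> k) i : \sum_i' T i' * (i' == i)%:R = T i.
Proof.
rewrite (bigD1 i) //= eqxx mulr1 big1 ?addr0 // => j /negbTE ->.
by rewrite mulr0.
Qed.

Lemma coef2_bivector L i j : coef2 i j (bivector L) = L i j.
Proof.
rewrite /bivector linear_sum -[RHS](sum_delta (L^~ j)); apply: eq_bigr => i' _.
rewrite linear_sum -[L i' j](sum_delta (L i')) mulr_suml;
  apply: eq_bigr => j' _.
(* scaling in k^o is multiplication *)
rewrite linearZ /= coef2_tens !mcoeffXU -[LHS]/(L i' j' * (_ * _)); ring.
Qed.

(** The trilinear analogue of [bivector]. *)
Definition trivector (T : 'I_d -> 'I_d -> 'I_d -> k) : A3 :=
  \sum_i \sum_j \sum_l T i j l *: ('X_i \ox 'X_j \ox 'X_l).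

Lemma coef3_trivector T i j l : coef3 i j l (trivector T) = T i j l.
Proof.
rewrite /trivector linear_sum -[RHS](sum_delta (fun i => T i j l)).
apply: eq_bigr => i' _; rewrite linear_sum -[T i' j l](sum_delta (fun j =>
  T i' j l)).
rewrite mulr_suml; apply: eq_bigr => j' _.
rewrite linear_sum -[T i' j' l](sum_delta (T i' j')) !mulr_suml.
apply: eq_bigr => l' _.
rewrite linearZ /= coef3_tens !mcoeffXU -[LHS]/(T i' j' l' * (_ * _ * _)); ring.
Qed.

Lemma eq_trivector T T' : (forall i j l, T i j l = T' i j l) ->
  trivector T = trivector T'.
Proof. by move=> e; do 3![apply: eq_bigr => ? _]; rewrite e. Qed.

Lemma trivectorD T T' :
  trivector T + trivector T' = trivector (fun i j l => T i j l + T' i j l).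
Proof.
rewrite /trivector; do 3![rewrite -big_split; apply: eq_bigr => ? _].
by rewrite scalerDl.
Qed.

Lemma t3_trivector T : t3 (trivector T) = trivector (fun i j l => T j l i).
Proof.
rewrite /trivector linear_sum.
transitivity (\sum_i \sum_j \sum_l T i j l *: ('X_l \ox 'X_i \ox 'X_j) : A3).
  apply: eq_bigr => i _; rewrite linear_sum; apply: eq_bigr => j _.
  rewrite linear_sum; apply: eq_bigr => l _.
  by rewrite linearZ /= t3_tens.
exact: sum3_rot (fun i j l => T i j l *: ('X_l \ox 'X_i \ox 'X_j)).
Qed.

Lemma t2_bivector L : t2 (bivector L) = bivector L^T.
Proof.
rewrite /bivector linear_sum exchange_big; apply: eq_bigr => j _.
rewrite linear_sum; apply: eq_bigr => i _.
by rewrite linearZ /= t2_tens mxE.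
Qed.

Lemma bivectorN L : bivector (- L) = - bivector L.
Proof.
rewrite /bivector -sumrN; apply: eq_bigr => j _.
by rewrite -sumrN; apply: eq_bigr => i _; rewrite mxE scaleNr.
Qed.

Lemma tmap_bivector (q : {linear A -> A2}) (lam : 'I_d -> 'M[k]_d) L :
    (forall s, q 'X_s = bivector (lam s)) ->
  tmap q id (bivector L) = trivector (fun i j m => \sum_l L l m * lam l i j).
Proof.
move=> qX; rewrite /bivector linear_sum.
transitivity (\sum_l \sum_m \sum_i \sum_j
    (L l m * lam l i j) *: ('X_i \ox 'X_j \ox 'X_m) : A3).
  apply: eq_bigr => l _; rewrite linear_sum; apply: eq_bigr => m _.
  rewrite linearZ /= tmap_idr /= qX /bivector tens_suml scaler_sumr.
  apply: eq_bigr => i _; rewrite tens_suml scaler_sumr; apply: eq_bigr => j _.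
  by rewrite tensZl scalerA.
rewrite (sum4_rev (fun l m i j => (L l m * lam l i j) *: ('X_i \ox 'X_j \ox
  'X_m))).
do 2![apply: eq_bigr => ? _].
by apply: eq_bigr => m _; rewrite scaler_suml.
Qed.

(** The co-Leibniz rule on a generator, as q(1) = 0. *)
Lemma coLeibniz_bivector L : L^T = - L ->
  tmap (@comult k d) id (bivector L)
  = t3 (bivector L \ox 1) - t3 (t3 (bivector L \ox 1)).
Proof.
move=> skL.
have e1 : t3 (bivector L \ox 1) = \sum_i \sum_j L i j *: (1 \ox 'X_i \ox 'X_j)
  :> A3.
  rewrite /bivector tens_suml linear_sum; apply: eq_bigr => i _.
  rewrite tens_suml linear_sum; apply: eq_bigr => j _.
  by rewrite tensZl linearZ /= t3_tens.
have e2 : t3 (t3 (bivector L \ox 1))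
    = - \sum_i \sum_j L i j *: ('X_i \ox 1 \ox 'X_j) :> A3.
  rewrite e1; transitivity (\sum_i \sum_j L i j *: ('X_j \ox 1 \ox 'X_i) : A3).
    rewrite linear_sum; apply: eq_bigr => i _.
    rewrite linear_sum; apply: eq_bigr => j _.
    by rewrite linearZ /= t3_tens.
  apply: etrans (exchange_big _ _ _ _ _ _) _; rewrite -sumrN;
    apply: eq_bigr => i _.
  rewrite -sumrN; apply: eq_bigr => j _.
  by rewrite -scaleNr; move/matrixP/(_ i j): skL; rewrite !mxE => ->.
rewrite e2 e1 opprK addrC /bivector linear_sum -big_split;
  apply: eq_bigr => i _.
rewrite linear_sum -big_split; apply: eq_bigr => j _.
by rewrite linearZ /= tmap_idr /= comultX tensDl scalerDr.
Qed.

Lemma bivector0 : bivector 0 = 0 :> A2.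
Proof. by rewrite /bivector big1 // => i _; rewrite big1 // => j _;
  rewrite mxE scale0r. Qed.

Lemma bivectorD (L M : 'M[k]_d) : bivector (L + M) = bivector L + bivector M.
Proof.
rewrite /bivector; do 2![rewrite -big_split; apply: eq_bigr => ? _].
by rewrite mxE scalerDl.
Qed.

Lemma bivectorZ c (L : 'M[k]_d) : bivector (c *: L) = c *: bivector L.
Proof.
rewrite /bivector; do 2![rewrite scaler_sumr; apply: eq_bigr => ? _].
by rewrite mxE scalerA.
Qed.

Lemma bivector_delta i j : bivector (delta_mx i j) = 'X_i \ox 'X_j :> A2.
Proof.
rewrite /bivector (bigD1 i) //= [X in _ + X]big1 => [|i' ni]; last first.
  by rewrite big1 // => j' _; rewrite mxE (negbTE ni) scale0r.
rewrite addr0 (bigD1 j) //= big1 => [|j' nj]; last first.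
  by rewrite mxE (negbTE nj) andbF scale0r.
by rewrite addr0 mxE !eqxx scale1r.
Qed.

Lemma bivector_of_supp (u : A2) :
    (forall mu, u@_mu != 0 -> mdeg (lmon mu) = 1%N /\ mdeg (rmon mu) = 1%N) ->
  exists L, u = bivector L.
Proof.
move=> supp_u; rewrite [u]mpolyE big_seq.
apply: (big_ind (fun v => exists L, v = bivector L)).
- by exists 0; rewrite bivector0.
- by move=> _ _ [L ->] [M ->]; exists (L + M); rewrite bivectorD.
move=> mu; rewrite mcoeff_msupp => /supp_u[/eqP/mdeg1P[i /eqP ei] /eqP/mdeg1P[j
  /eqP ej]].
by exists (u@_mu *: delta_mx i j); rewrite bivectorZ bivector_delta -tensXX ei
  ej.
Qed.

(** * Values on generators in characteristic zero *)

(** The multiplication A (x) A -> A. *)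
Definition prod_map : A2 -> A := tlift (fun a b : A => a * b).
HB.instance Definition _ :=
  GRing.Linear.copy prod_map (tlift (fun a b : A => a * b)).

Lemma prod_map_tens a b : prod_map (a \ox b) = a * b.
Proof.
rewrite /prod_map tlift_tens // => [b' x a1 a2|a' x b1 b2].
- by rewrite mulrDl -scalerAl.
- by rewrite mulrDr -scalerAr.
Qed.

Lemma prod_mapM : {morph prod_map : u v / u * v}.
Proof. by apply: tlift_mul => a a' b b'; rewrite mulrACA. Qed.

Lemma prod_comultX (m : 'X_{1..d}) :
  prod_map (comult 'X_[m]) = 2%:R ^+ mdeg m *: 'X_[m].
Proof.
elim/multinom_ind: m => [|i m IH].
  by rewrite mpolyX0 rmorph1 -tens11 prod_map_tens mulr1 mdeg0 expr0 scale1r.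
rewrite mpolyXD rmorphM prod_mapM IH /= comultX linearD /= !prod_map_tens mulr1
  mul1r.
by rewrite mdegD mdeg1 add1n exprS -scalerAr -mulr2n -scaler_nat -scalerAl
  scalerA mulrC.
Qed.

(** A linear map that is diagonal in the monomial basis acts on coefficients. *)
Lemma mcoeff_diag N (F : {linear {mpoly k[N]} ->
  {mpoly k[N]}}) (c : 'X_{1..N} -> k) :
  (forall m, F 'X_[m] = c m *: 'X_[m]) -> forall u m, (F u)@_m = c m * u@_m.
Proof.
move=> FX u m; elim/mpolyind: u => [|x n u _ _ IH].
  by rewrite linear0 mcoeff0 mulr0.
rewrite linearP /= FX !(mcoeffD, mcoeffZ) IH mcoeffX mulrDr; congr (_ + _).
by case: eqP => [->|]; rewrite ?mulr0 // !mulr1 mulrC.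
Qed.

Lemma expr2n_eq2 n : [pchar k] =i pred0 -> 2%:R ^+ n = 2%:R :> k -> n = 1%N.
Proof.
move=> ch0; have nz := (pcharf0P k).1 ch0.
case: n => [|[//|n]] /eqP.
  by rewrite expr0 -[X in X == _]addr0 (natrD _ 1 1) (inj_eq (addrI _)) eq_sym
    oner_eq0.
rewrite -natrX -subr_eq0 -natrB; last by rewrite expnS leq_pmulr ?expn_gt0.
by rewrite nz subn_eq0 expnS -[leqRHS]muln1 leq_pmul2l // leqNgt -{1}(expn0 2)
  ltn_exp2l.
Qed.

Lemma tens_r_ext m n p (W : lmodType k) (c : {mpoly k[p]})
    (F : {linear {mpoly k[m + n + p]} -> W}) (G : {linear {mpoly k[m + n]} ->
      W}) :
  (forall a b, F (a \ox b \ox c) = G (a \ox b)) -> forall u, F (u \ox c) = G u.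
Proof.
move=> eqFG u; rewrite [u]mpolyE tens_suml !linear_sum; apply: eq_bigr => mu _.
by rewrite tensZl !linearZ /= -tensXX eqFG.
Qed.

Section Doubling.

(* dbl sends x_i to 2 x_i *)
Let dbl : {linear A -> A} := prod_map \o @comult k d.

(** The result of multiplying the first two factors in the co-Leibniz rule. *)
Lemma double_of_coLeibniz (u : A2) : t2 u = - u ->
    tmap (@comult k d) id u = t3 (u \ox 1) - t3 (t3 (u \ox 1)) ->
  tmap dbl id u = u + u.
Proof.
move=> sku cL.
have cdbl v : tmap prod_map id (tmap (@comult k d) id v) = tmap dbl id v :> A2.
  apply: (tens_ext (F := tmap prod_map id \o tmap (@comult k d) id)
    (G := tmap dbl id)) v.
  by move=> a b; rewrite /= !tmap_idr.
have p1 v : tmap prod_map id (t3 (v \ox 1)) = v :> A2.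
  apply: (tens_r_ext (F := tmap prod_map id \o @t3 k d) (G := idfun)) => a b.
  by rewrite /= t3_tens tmap_idr /= prod_map_tens mul1r.
have p2 v : tmap prod_map id (t3 (t3 (v \ox 1))) = t2 v :> A2.
  apply: (tens_r_ext (F := tmap prod_map id \o (@t3 k d \o @t3 k d))
    (G := @t2 k d)) => a b.
  by rewrite /= !t3_tens t2_tens tmap_idr /= prod_map_tens mulr1.
by rewrite -cdbl cL linearB /= p1 p2 sku opprK.
Qed.

Lemma bivector_of_coLeibniz (u : A2) : [pchar k] =i pred0 -> t2 u = - u ->
    tmap (@comult k d) id u = t3 (u \ox 1) - t3 (t3 (u \ox 1)) ->
  exists L, u = bivector L.
Proof.
move=> ch0 sku cL; have dl := double_of_coLeibniz sku cL.
(* by skew-symmetry, the same holds on the right factor *)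
have dr : tmap id dbl u = u + u.
  have tsw v : tmap id dbl (t2 v) = t2 (tmap dbl id v).
    apply: (tens_ext (F := tmap id dbl \o @t2 k d)
      (G := @t2 k d \o tmap dbl id)) v.
    by move=> a b; rewrite /= tmap_idr !t2_tens tmap_idl.
  have := tsw u; rewrite dl sku linearN linearD /= sku -opprD.
  by move/oppr_inj.
have nz (c x : k) : x != 0 -> c * x = x + x -> c = 2%:R.
  by move=> xn0 e; apply: (mulIf xn0); rewrite e mulr_natl mulr2n.
apply: bivector_of_supp => mu un0; split; apply: (expr2n_eq2 ch0);
  apply: (nz _ u@_mu) => //.
- rewrite -[X in _ = X]mcoeffD -dl.
  rewrite (mcoeff_diag (c := fun mu => 2%:R ^+ mdeg (lmon mu))) // => m.
  by rewrite /= -tensXX tmap_idr /= prod_comultX tensZl.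
- rewrite -[X in _ = X]mcoeffD -dr.
  rewrite (mcoeff_diag (c := fun mu => 2%:R ^+ mdeg (rmon mu))) // => m.
  by rewrite /= -tensXX tmap_idl /= prod_comultX tensZr.
Qed.

End Doubling.

(** * Alternating coefficients and the co-Jacobi identity *)

Lemma alternating_eq0 (V : zmodType) (J : 'I_d -> 'I_d -> 'I_d -> V) :
    (forall i j m, J i j m = J j m i) -> (forall i j m, J j i m = - J i j m) ->
    (forall i m, J i i m = 0) ->
    (forall i j m : 'I_d, (i < j)%N -> (j < m)%N -> J i j m = 0) ->
  forall i j m, J i j m = 0.
Proof.
move=> cyc alt diag inc.
have H (i j m : 'I_d) : (i < j)%N -> J i j m = 0.
  move=> ij; have [jm|mj|/val_inj <-] := ltngtP j m.
  - exact: inc.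
  - have [im|mi|/val_inj <-] := ltngtP i m.
    + by rewrite cyc cyc alt inc ?oppr0.
    + by rewrite cyc cyc inc.
    + by rewrite cyc cyc diag.
  - by rewrite cyc diag.
move=> i j m; have [ij|ji|/val_inj ->] := ltngtP i j; last exact: diag.
- exact: H.
- by rewrite alt H ?oppr0.
Qed.

(** In characteristic 2 the vanishing of the diagonal does not follow from
   skew-symmetry; it is what membership in the span of the
   x_i (x) x_j - x_j (x) x_i adds. *)
Lemma in_calI_bivector (L : 'M[k]_d) :
  in_calI (bivector L) <-> L^T = - L /\ forall i, L i i = 0.
Proof.
split=> [[c cL]|[skL L0]].
  suff LE i j : L i j = \sum_(a < d) \sum_(b < d | (a < b)%N)
      c a b * ((a == i)%:R * (b == j)%:R - (b == i)%:R * (a == j)%:R).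
    split=> [|i].
      apply/matrixP => i j; rewrite !mxE !LE -sumrN; apply: eq_bigr => a _.
      by rewrite -sumrN; apply: eq_bigr => b _; ring.
    by rewrite LE big1 // => a _; rewrite big1 // => b _; ring.
  rewrite -coef2_bivector cL linear_sum; apply: eq_bigr => a _.
  rewrite linear_sum; apply: eq_bigr => b _.
  by rewrite linearZ linearB /= !coef2_tens !mcoeffXU.
exists (fun i j => L i j); rewrite /bivector.
have skE i j : L j i = - L i j by move/matrixP/(_ i j): skL; rewrite !mxE.
transitivity (\sum_(i < d) (\sum_(j < d | (i < j)%N) L i j *: ('X_i \ox 'X_j)
   + \sum_(j < d | (j < i)%N) L i j *: ('X_i \ox 'X_j)) : A2).
  apply: eq_bigr => i _; rewrite (bigID (fun j : 'I_d => (i < j)%N)) /=;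
    congr (_ + _).
  rewrite (bigD1 i) ?ltnn //= L0 scale0r add0r; apply: eq_bigl => j.
  by rewrite -leqNgt ltn_neqAle andbC.
rewrite big_split /= [X in _ + X](exchange_big_dep xpredT) //= -big_split /=.
apply: eq_bigr => i _; rewrite -big_split; apply: eq_bigr => j _ /=.
by rewrite (skE i j) scaleNr scalerBr.
Qed.

Lemma jacobiator_bivector (q : {linear A -> A2}) (lam : 'I_d -> 'M[k]_d) L :
    (forall s, q 'X_s = bivector (lam s)) ->
  let w := tmap q id (bivector L) in
  w + t3 w + t3 (t3 w) = trivector (fun i j m => \sum_l
     (L l m * lam l i j + L l i * lam l j m + L l j * lam l m i)).
Proof.
move=> qX w; rewrite /w (tmap_bivector _ qX) !t3_trivector !trivectorD.
by apply: eq_trivector => i j m; rewrite -!big_split.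
Qed.

(** The coefficients are invariant under rotation, change sign when the first
   two indices are swapped, and vanish when these agree. *)
Lemma jacobiator_eq0 (lam : 'I_d -> 'M[k]_d) (L : 'M[k]_d) :
    (forall s, (lam s)^T = - lam s /\ forall i, lam s i i = 0) ->
    let J i j m := \sum_l (L l m * lam l i j + L l i * lam l j m + L l j * lam
      l m i) in
    (forall i j m : 'I_d, (i < j)%N -> (j < m)%N -> J i j m = 0) ->
  forall i j m, J i j m = 0.
Proof.
move=> altL J; have sk s i j : lam s j i = - lam s i j.
  by have [/matrixP/(_ i j)] := altL s; rewrite !mxE.
apply: alternating_eq0 => [i j m|i j m|i m].
- by apply: eq_bigr => l _; rewrite -addrA addrC.
- rewrite /J -sumrN; apply: eq_bigr => l _.
  by rewrite (sk l i j) (sk l m i) (sk l j m); ring.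
- apply: big1 => l _; rewrite (altL l).2 (sk l i m); ring.
Qed.

End Bivectors.

Theorem proposition5p4 (k : fieldType) (d : nat)
    (q : {linear {mpoly k[d]} -> {mpoly k[d + d]}}) :
  let I_conditions :=
    exists (I : {linear {mpoly k[d]} -> {mpoly k[d + d]}})
           (lambda : 'I_d -> 'M[k]_d),
      [/\ forall m : 'X_{1..d}, q 'X_[m] = sweedler_mul I (@comult k d) 'X_[m],
          forall m : 'X_{1..d},
            (forall s : 'I_d, 'X_[m] != 'X_s :> {mpoly k[d]}) -> I 'X_[m] = 0,
          forall s : 'I_d,
            [/\ I 'X_s =
                  \sum_(i < d) \sum_(j < d) lambda s i j *: ('X_i \ox 'X_j),
                in_calI (I 'X_s) &
                (lambda s)^T = - lambda s] &
          forall i j m s : 'I_d, (i < j)%N -> (j < m)%N ->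
            \sum_(l < d) (lambda s l m * lambda l i j
                          + lambda s l i * lambda l j m
                          + lambda s l j * lambda l m i) = 0] in
  ([pchar k] =i pred0 -> is_coPoissonHopf q -> I_conditions)
  /\ (I_conditions -> is_coPoissonHopf q).
Proof.
move=> I_conditions; split=> [ch0 [sk jac cL qD]|[I [lam [qI I0 IX jac]]]].
- have q1 : q 1 = 0 by apply: derivation_along1 qD; rewrite rmorph1.
  have sk' a : t2 (q a) = - q a by apply/eqP; rewrite -addr_eq0 addrC sk.
  have cLX s : tmap (@comult k d) id (q 'X_s)
    = t3 (q 'X_s \ox 1) - t3 (t3 (q 'X_s \ox 1)).
    by rewrite cL coLeibnizE comultX linearD /= !tmap_idr q1 tens0l addr0.
  have [lam qX] : exists lam : 'I_d -> 'M[k]_d, forall s, q 'X_s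
    = bivector (lam s).
    apply: (fin_all_exists (U := fun _ => 'M[k]_d) (P := fun s L =>
      q 'X_s = bivector L)) => s.
    exact: (bivector_of_coLeibniz ch0 (sk' _) (cLX s)).
  have nz := (pcharf0P k).1 ch0.
  have lamA s : (lam s)^T = - lam s /\ forall i, lam s i i = 0.
    have lamT : (lam s)^T = - lam s.
      apply/matrixP => i j; have := sk' 'X_s; rewrite qX t2_bivector -bivectorN.
      by move/(congr1 (coef2 i j)); rewrite !coef2_bivector.
    split=> // i; move/matrixP/(_ i i): lamT; rewrite !mxE => /eqP.
    by rewrite -addr_eq0 -mulr2n -mulr_natl mulf_eq0 nz => /eqP.
  exists (linear_part (fun s => q 'X_s)), lam; split.
  + by move=> m; apply: sweedler_derivation.
  + move=> m ne; apply: linear_part_other => s; rewrite -(mpolyX_neq k);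
    exact: ne.
  + move=> s; rewrite /= linear_partX qX; split=> //; last by case: (lamA s).
    exact/in_calI_bivector.
  + move=> i j m s _ _; have := jac 'X_s.
    rewrite /= qX (jacobiator_bivector _ qX) => /(congr1 (coef3 i j m)).
    by rewrite coef3_trivector linear0.
- have [qD qIX] := derivation_sweedler I0 qI.
  have qX s : q 'X_s = bivector (lam s) by rewrite qIX; case: (IX s).
  have lamA s : (lam s)^T = - lam s /\ forall i, lam s i i = 0.
    by apply/in_calI_bivector; rewrite -qX qIX; case: (IX s).
  have q1 : q 1 = 0 by apply: derivation_along1 qD; rewrite rmorph1.
  have cL : forall a, tmap (@comult k d) id (q a)
      = t3 (tmap q id (comult a)) - t3 (t3 (tmap q id (comult a))).
    apply: (coLeibniz_of_gens qD) => s.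
    rewrite comultX linearD /= !tmap_idr q1 tens0l addr0 qX.
    by apply: coLeibniz_bivector; case: (lamA s).
  split=> //.
  + apply: (skew_of_gens qD) => s.
    by rewrite qX t2_bivector (lamA s).1 bivectorN.
  + apply: (jacobi_of_gens qD cL) => s.
    rewrite qX (jacobiator_bivector _ qX).
    have J0 := jacobiator_eq0 lamA (fun i j m => jac i j m s).
    rewrite (eq_trivector J0) /trivector.
    by do 3![rewrite big1 // => ? _]; rewrite scale0r.
  + by move=> a; rewrite coLeibnizE cL.
Qed.
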